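(* Let $\mathbb{K}=\mathbb{R}$ or $\mathbb{C}$, $d\ge1$, let $\|\cdot\|$ be a norm on $\mathbb{K}^{d\times d}$ and let $\mathcal{M}\subseteq\mathbb{K}^{d\times d}$ be nonempty and compact with index of reducibility $m$. Let $V$ be a linear subspace of $\mathbb{K}^{d\times d}$, let $\mathcal{B}_V=\{A\in V : \|A\|\le1\}$ and define $\mathcal{M}_\varepsilon:=\mathcal{M}+\varepsilon\mathcal{B}_V$ for $\varepsilon\ge0$. Then $r:[0,\infty)\to\mathbb{R}$, $r(\varepsilon):=\rho(\mathcal{M}_\varepsilon)$, is increasing (in the weak sense). In addition, $r$ is Hölder continuous at $0$ with exponent $1/m$. In particular, for any $\eta>0$ there exists a constant $C_\eta$ such that $$r(\varepsilon)-r(0)\le C_\eta\,\varepsilon^{1/m},\qquad \varepsilon\in[0,\eta].$$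
   Context: The joint spectral radius of a nonempty compact set $\mathcal{N}\subseteq\mathbb{K}^{d\times d}$ is $\rho(\mathcal{N})=\lim_{k\to\infty}\sup\{\|S\| : S\in\mathcal{S}_k(\mathcal{N})\}^{1/k}$ with $\mathcal{S}_k(\mathcal{N})=\{A_{k-1}\cdots A_0 : A_j\in\mathcal{N}\}$ and any operator norm. $\mathcal{M}+\varepsilon\mathcal{B}_V=\{A+\varepsilon B : A\in\mathcal{M}, B\in\mathcal{B}_V\}$. The index of reducibility of $\mathcal{M}$ is the length $m$ of a maximal flag $\{0\}=F_0\subsetneq F_1\subsetneq\cdots\subsetneq F_m=\mathbb{K}^d$ of subspaces each of which is $A$-invariant for all $A\in\mathcal{M}$. A function $f$ between metric spaces is Hölder continuous at $x_0$ with exponent $\alpha$ if $\limsup_{x\to x_0,\,x\neq x_0} d_Z(f(x),f(x_0))/d_X(x,x_0)^\alpha<\infty$. *)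

(* Defs.v *)
From mathcomp Require Import all_boot all_order all_algebra.
From mathcomp Require Import all_classical all_reals all_analysis.
From mathcomp Require Import complex.

Set Implicit Arguments.
Unset Strict Implicit.
Unset Printing Implicit Defensive.

Import Order.TTheory GRing.Theory Num.Theory.
Import numFieldNormedType.Exports.

Local Open Scope classical_set_scope.
Local Open Scope ring_scope.

(* The base field is R or R[i]; it is selected by a tag so that a single
   statement covers both cases. *)
Variant scalar_kind := RealScalars | ComplexScalars.

Definition base_field (R : realType) (s : scalar_kind) : numFieldType :=
  match s with
  | RealScalars => R
  | ComplexScalars => R[i]
  end.

(* The absolute value of a scalar as an element of R: the norm `|z| of R[i]
   takes its values in R[i]. *)
Definition modulus (R : realType) (s : scalar_kind) : base_field R s -> R :=
  match s return base_field R s -> R with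
  | RealScalars => fun x : R => `|x|
  | ComplexScalars => fun z : R[i] => complex.Re `|z|
  end.

Definition of_real (R : realType) (s : scalar_kind) : R -> base_field R s :=
  match s return R -> base_field R s with
  | RealScalars => fun x : R => x
  | ComplexScalars => fun x : R => real_complex R x
  end.

(* Nonnegativity and N 0 = 0 follow from these three clauses. *)
Definition is_norm (R : realType) (s : scalar_kind)
    (E : lmodType (base_field R s)) (N : E -> R) : Prop :=
  [/\ forall x, N x = 0 -> x = 0,
      forall (a : base_field R s) x, N (a *: x) = modulus a * N x &
      forall x y, N (x + y) <= N x + N y].

Definition operator_norm (R : realType) (s : scalar_kind) (d : nat)
    (nu : 'cV[base_field R s]_d -> R) (A : 'M[base_field R s]_d) : R :=
  sup [set nu (A *m x) | x in [set x | nu x <= 1]].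

(* S_k(N); rev_ord puts A_(k-1) leftmost. *)
Definition products (K : numFieldType) (d k : nat) (N : set 'M[K]_d) :
    set 'M[K]_d :=
  [set \prod_(j < k) A (rev_ord j) |
     A in [set A : 'I_k -> 'M[K]_d | forall j, N (A j)]].

Definition joint_spectral_radius (R : realType) (s : scalar_kind) (d : nat)
    (nu : 'cV[base_field R s]_d -> R) (N : set 'M[base_field R s]_d) : R :=
  limn (fun k : nat =>
    sup [set operator_norm nu S | S in products k N] `^ k%:R^-1).

(* M + eps B_V *)
Definition perturbed (R : realType) (s : scalar_kind) (d : nat)
    (N : 'M[base_field R s]_d -> R) (V : {vspace 'M[base_field R s]_d})
    (M : set 'M[base_field R s]_d) (eps : R) : set 'M[base_field R s]_d :=
  [set A + of_real s eps *: B |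
     A in M & B in [set B | B \in V /\ N B <= 1]].

Definition invariant_subspace (K : numFieldType) (d : nat)
    (M : set 'M[K]_d) (W : {vspace 'cV[K]_d}) : Prop :=
  forall A, M A -> forall x, x \in W -> A *m x \in W.

(* F 0, ..., F m is a flag; the values F i with i > m are irrelevant. *)
Definition invariant_flag (K : numFieldType) (d : nat)
    (M : set 'M[K]_d) (m : nat) (F : nat -> {vspace 'cV[K]_d}) : Prop :=
  [/\ F 0%N = 0%VS, F m = fullv,
      forall i, (i < m)%N -> (F i <= F i.+1)%VS /\ F i != F i.+1 &
      forall i, (i <= m)%N -> invariant_subspace M (F i)].

(* Maximality is with respect to refinement; by the Jordan-Hoelder theorem
   all maximal flags have the same length. *)
Definition maximal_invariant_flag (K : numFieldType) (d : nat)
    (M : set 'M[K]_d) (m : nat) (F : nat -> {vspace 'cV[K]_d}) : Prop :=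
  invariant_flag M m F /\
  forall n G, invariant_flag M n G ->
    (forall i, (i <= m)%N -> exists2 j, (j <= n)%N & G j = F i) -> n = m.

Definition index_of_reducibility (K : numFieldType) (d : nat)
    (M : set 'M[K]_d) (m : nat) : Prop :=
  exists F, maximal_invariant_flag M m F.

(* f is considered as a function on the subspace D of X. *)
Definition holder_continuous_at (R : realType) (X Z : metricType R)
    (D : set X) (f : X -> Z) (x0 : X) (alpha : R) : Prop :=
  (limf_esup (fun x => (mdist (f x) (f x0) / mdist x x0 `^ alpha)%:E)
     (within (D `\ x0) (nbhs x0)) < +oo)%E.

(* Main.v *)
Require Import Defs.
From mathcomp Require Import all_boot all_order all_algebra.
From mathcomp Require Import all_classical all_reals all_analysis.
From mathcomp Require Import complex.
From mathcomp Require Import zify lra.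
Import Order.TTheory GRing.Theory Num.Theory.
Import numFieldNormedType.Exports.
Local Open Scope classical_set_scope.
Local Open Scope ring_scope.
Set Implicit Arguments.
Unset Strict Implicit.
Unset Printing Implicit Defensive.

(** The increments of [r] are controlled by exhibiting, for each size of the
    perturbation, a norm in which every perturbed matrix has operator norm
    close to [rho], the joint spectral radius of [M]: such a norm bounds the
    joint spectral radius ([jsr_le]), all norms being equivalent
    ([seminorm_le_norm]).

    The norm is built along a maximal invariant flag.  Between two consecutive
    members [W] and [U] of the flag [M] acts irreducibly, and this makes the
    products of length [k] bounded by a constant times [rho ^ k] modulo [W].
    Indeed some vector outside [W] is never expanded by more than [rho ^ k]
    modulo [W] ([nonexpanded_vector]): otherwise compactness would provide one
    rate larger than [rho] valid for all vectors, and iteration would push the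
    joint spectral radius above [rho].  The vectors with bounded normalised
    orbits form an invariant subspace strictly larger than [W], hence all of
    [U] ([orbits_bounded]).  The supremum over the orbit is then a seminorm on
    [U], with kernel [W], that no matrix of [M] expands by more than [rho]
    ([extremal_seminorm]).  This includes the case where [rho] vanishes.

    Splitting the space along the flag ([flag_decomposition]) makes the
    matrices of [M] block upper triangular, with [m] diagonal blocks of norm at
    most [rho] ([adapted_seminorms]).  Rescaling the [i]-th component by
    [delta ^ (m - 1 - i)] makes the blocks above the diagonal of order [delta],
    at the price of inflating a perturbation by at most [delta ^ (1 - m)].  The
    two effects balance when the perturbation has size [delta ^ m], and the
    total increase is of order [delta], the [m]-th root of the size
    ([perturbed_jsr_le]).

    Monotonicity follows from inclusion of the perturbed sets, once Fekete's
    lemma ([submultiplicative_root_cvg]) ensures that the limits exist. *)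

(** * Scalars and seminorms *)

Section Scalars.
Context {R : realType} {s : scalar_kind}.
Implicit Types z w : base_field R s.

Lemma norm_modulus z : `|z| = of_real s (modulus z).
Proof.
by case: s z => [z|[a b]].
Qed.

Lemma of_realM (a b : R) : of_real s (a * b) = of_real s a * of_real s b.
Proof. by case: s => //=; exact: rmorphM. Qed.

Lemma of_realD (a b : R) : of_real s (a + b) = of_real s a + of_real s b.
Proof. by case: s => //=; exact: rmorphD. Qed.

Lemma of_real0 : of_real s (0 : R) = 0.
Proof. by case: s. Qed.

Lemma of_real1 : of_real s (1 : R) = 1.
Proof. by case: s. Qed.

Lemma ler_of_real (a b : R) : (of_real s a <= of_real s b) = (a <= b).
Proof. by case: s => //=; rewrite lecE /= eqxx. Qed.

Lemma ltr_of_real (a b : R) : (of_real s a < of_real s b) = (a < b).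
Proof. by case: s => //=; rewrite ltcE /= eqxx. Qed.

Lemma of_real_inj : injective (@of_real R s).
Proof. by case: s => //=; exact: complexI. Qed.

Lemma modulus_ge0 z : 0 <= modulus z.
Proof. by rewrite -ler_of_real -norm_modulus of_real0 normr_ge0. Qed.

Lemma modulus_eq0 z : (modulus z == 0) = (z == 0).
Proof.
by rewrite -[RHS]normr_eq0 norm_modulus -of_real0 (inj_eq of_real_inj).
Qed.

Lemma modulusM z w : modulus (z * w) = modulus z * modulus w.
Proof. by apply: of_real_inj; rewrite of_realM -!norm_modulus normrM. Qed.

Lemma modulusD z w : modulus (z + w) <= modulus z + modulus w.
Proof. by rewrite -ler_of_real of_realD -!norm_modulus ler_normD. Qed.

Lemma modulusN z : modulus (- z) = modulus z.
Proof. by apply: of_real_inj; rewrite -!norm_modulus normrN. Qed.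

Lemma modulus0 : modulus (0 : base_field R s) = 0.
Proof. by apply/eqP; rewrite modulus_eq0. Qed.

Lemma modulus1 : modulus (1 : base_field R s) = 1.
Proof. by apply: of_real_inj; rewrite -norm_modulus normr1 of_real1. Qed.

Lemma modulus_of_real (a : R) : 0 <= a -> modulus (of_real s a) = a.
Proof.
move=> a0; apply: of_real_inj.
by rewrite -norm_modulus ger0_norm // -of_real0 ler_of_real.
Qed.

Lemma modulus_lt1 z : `|z| < 1 -> modulus z < 1.
Proof. by rewrite norm_modulus -of_real1 ltr_of_real. Qed.

(** Both scalar fields are Lipschitz images of the real plane, so that
    compactness over either field reduces to compactness of real boxes. *)
Definition of_coords (a b : R) : base_field R s :=
  match s return base_field R s with
  | RealScalars => a
  | ComplexScalars => (a +i* b)%C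
  end.

Lemma of_coords_onto z :
  exists a b, [/\ `|a| <= modulus z, `|b| <= modulus z & z = of_coords a b].
Proof.
rewrite /of_coords; case: s z => [z|[a b]] /=.
  by exists z, 0; split => //; rewrite normr0.
exists a, b; split => //; rewrite -sqrtr_sqr ler_wsqrtr //.
  by rewrite lerDl sqr_ge0.
by rewrite lerDr sqr_ge0.
Qed.

Lemma of_coords_lipschitz (a b a' b' : R) :
  modulus (of_coords a b - of_coords a' b') <= `|a - a'| + `|b - b'|.
Proof.
rewrite /of_coords; case: s => /=; first by rewrite lerDl.
set x := a - a'; set y := b - b'.
have xy0 : 0 <= `|x| + `|y| by rewrite addr_ge0.
rewrite -[leRHS]ger0_norm // -[leRHS]sqrtr_sqr ler_wsqrtr //.
rewrite [leRHS]sqrrD !real_normK ?num_real // -addrAC lerDl.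
by rewrite mulrn_wge0 // mulr_ge0.
Qed.

End Scalars.

Section Seminorms.
Context {R : realType} {s : scalar_kind}.
Local Notation K := (base_field R s).

(** Seminorms, besides norms, are needed because sizes are measured modulo a
    subspace. *)
Definition is_seminorm {E : lmodType K} (p : E -> R) : Prop :=
  (forall (a : K) x, p (a *: x) = modulus a * p x) /\
  (forall x y, p (x + y) <= p x + p y).

Lemma norm_seminorm {E : lmodType K} {N : E -> R} :
  is_norm N -> is_seminorm N.
Proof. by case. Qed.

Section Theory.
Context {E : lmodType K} {p : E -> R} (sp : is_seminorm p).

Lemma seminormZ a x : p (a *: x) = modulus a * p x.
Proof. by case: sp. Qed.

Lemma seminormD x y : p (x + y) <= p x + p y.
Proof. by case: sp. Qed.

Lemma seminorm0 : p 0 = 0.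
Proof. by rewrite -(scale0r 0) seminormZ modulus0 mul0r. Qed.

Lemma seminormN x : p (- x) = p x.
Proof. by rewrite -scaleN1r seminormZ modulusN modulus1 mul1r. Qed.

Lemma seminorm_ge0 x : 0 <= p x.
Proof.
have := seminormD x (- x); rewrite subrr seminorm0 seminormN -mulr2n.
by rewrite pmulrn_lge0.
Qed.

Lemma seminorm_sub_le x y : p x - p y <= p (x - y).
Proof. by rewrite lerBlDr; have := seminormD (x - y) y; rewrite subrK. Qed.

Lemma seminorm_sum (I : Type) (r : seq I) (P : pred I) (F : I -> E) :
  p (\sum_(i <- r | P i) F i) <= \sum_(i <- r | P i) p (F i).
Proof.
elim/big_ind2: _ => //; first by rewrite seminorm0.
by move=> x a y b pxa pyb; apply: le_trans (seminormD _ _) (lerD pxa pyb).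
Qed.

Lemma seminorm_congr x y : p (x - y) = 0 -> p x = p y.
Proof.
move=> pxy; apply/eqP; rewrite eq_le; apply/andP; split.
  by rewrite -subr_le0 -pxy seminorm_sub_le.
by have := seminorm_sub_le y x; rewrite -[y - x]opprB seminormN pxy subr_le0.
Qed.

End Theory.

Lemma norm_gt0 {E : lmodType K} {N : E -> R} : is_norm N ->
  forall x, x != 0 -> 0 < N x.
Proof.
move=> nN x x0; rewrite lt_neqAle (seminorm_ge0 (norm_seminorm nN)) andbT.
rewrite eq_sym; apply: contra x0 => /eqP Nx.
by case: nN => /(_ x Nx) ->.
Qed.

Lemma seminorm_comp {E F : lmodType K} (f : E -> F) (p : F -> R) :
  linear f -> is_seminorm p -> is_seminorm (p \o f).
Proof.
move=> lf sp.
have f0 : f 0 = 0.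
  by have := lf (-1) 0 0; rewrite scaler0 addr0 scaleN1r addNr.
split=> [a x|x y] /=.
  by rewrite -[a *: x]addr0 lf f0 addr0 seminormZ.
by rewrite -[x]scale1r lf !scale1r seminormD.
Qed.

End Seminorms.

(** * Compactness and equivalence of norms *)

Section EntrySum.
Context {R : realType} {s : scalar_kind} {p q : nat}.
Local Notation K := (base_field R s).
Implicit Types A B : 'M[K]_(p, q).

Definition entry_sum A : R := \sum_i \sum_j modulus (A i j).

Lemma modulus_le_entry_sum A i j : modulus (A i j) <= entry_sum A.
Proof.
rewrite /entry_sum (bigD1 i) //= (bigD1 j) //= -addrA lerDl.
apply: addr_ge0; first by apply: sumr_ge0 => *; exact: modulus_ge0.
by apply: sumr_ge0 => *; apply: sumr_ge0 => *; exact: modulus_ge0.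
Qed.

Lemma entry_sum_norm : is_norm entry_sum.
Proof.
split=> [A A0|a A|A B].
- apply/matrixP => i j; rewrite mxE; apply/eqP; rewrite -modulus_eq0.
  by rewrite eq_le modulus_ge0 andbT -A0 modulus_le_entry_sum.
- rewrite /entry_sum mulr_sumr; apply: eq_bigr => i _.
  by rewrite mulr_sumr; apply: eq_bigr => j _; rewrite mxE modulusM.
- rewrite /entry_sum -big_split /=; apply: ler_sum => i _.
  rewrite -big_split /=; apply: ler_sum => j _.
  by rewrite mxE modulusD.
Qed.

Lemma entry_sum_seminorm : is_seminorm entry_sum.
Proof. exact: norm_seminorm entry_sum_norm. Qed.

Lemma seminorm_le_of_delta (f : 'M[K]_(p, q) -> R) c : is_seminorm f ->
  (forall i j, f (delta_mx i j) <= c) -> forall A, f A <= c * entry_sum A.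
Proof.
move=> sf fc A; rewrite {1}(matrix_sum_delta A) /entry_sum mulr_sumr.
apply: le_trans (seminorm_sum sf _ _ _) _; apply: ler_sum => i _.
rewrite mulr_sumr; apply: le_trans (seminorm_sum sf _ _ _) _.
by apply: ler_sum => j _; rewrite (seminormZ sf) mulrC ler_wpM2r ?modulus_ge0.
Qed.

Lemma seminorm_le_entry_sum (f : 'M[K]_(p, q) -> R) : is_seminorm f ->
  exists2 C, 0 < C & forall A, f A <= C * entry_sum A.
Proof.
move=> sf; pose C := \sum_i \sum_j f (delta_mx i j).
have C0 : 0 <= C.
  by apply: sumr_ge0 => *; apply: sumr_ge0 => *; exact: seminorm_ge0.
exists (C + 1); first by rewrite ltr_wpDl.
apply: seminorm_le_of_delta => // i j; apply: le_trans (_ : C <= _).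
  rewrite /C (bigD1 i) //= (bigD1 j) //= -addrA lerDl.
  apply: addr_ge0; first by apply: sumr_ge0 => *; exact: seminorm_ge0.
  by apply: sumr_ge0 => *; apply: sumr_ge0 => *; exact: seminorm_ge0.
by rewrite lerDl.
Qed.

Lemma seminorm_gt0_near (f : 'M[K]_(p, q) -> R) A : is_seminorm f -> 0 < f A ->
  exists2 e, 0 < e & forall B, entry_sum (B - A) < e -> 0 < f B.
Proof.
move=> sf fA; have [C C0 fC] := seminorm_le_entry_sum sf.
exists (f A / C); first by rewrite divr_gt0.
move=> B; rewrite ltr_pdivlMr // mulrC => BA.
have := seminorm_sub_le sf A B.
rewrite -[A - B]opprB (seminormN sf) =>
  /le_lt_trans/(_ (le_lt_trans (fC _) BA)).
by rewrite ltrBlDr ltrDl.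
Qed.

(** Compactness of the unit ball in the form used below: a property that
    holds locally from some rank on holds on the ball from some rank on.  The
    ball is covered by the image of a real box, compact by Tychonoff. *)
Lemma ball_uniform (P : nat -> 'M[K]_(p, q) -> Prop) :
  (forall A, exists2 e, 0 < e & exists n0, forall n B,
     (n0 <= n)%N -> entry_sum (B - A) < e -> P n B) ->
  exists n, forall A, entry_sum A <= 1 -> P n A.
Proof.
move=> locP; pose J := ('I_p * 'I_q * bool)%type.
pose T (j : J) : topologicalType := R.
pose X := prod_topology T.
pose phi (v : X) : 'M[K]_(p, q) :=
  \matrix_(i, j) of_coords (v (i, j, false)) (v (i, j, true)).
have cpt : compact ([set v | forall j, (`[-1, 1]%classic : set R) (v j)]
    : set X).
  by apply: (@tychonoff J T (fun=> `[-1, 1]%classic : set R)) => j;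
     exact: segment_compact.
have /compact_near_coveringP cov := cpt.
have [] : \forall n \near \oo,
    [set v : X | forall j, (`[-1, 1]%classic : set R) (v j)]
      `<=` (fun v => P n (phi v)).
  apply: cov => v _.
  have [e e0 [n0 Pn]] := locP (phi v).
  pose c := (2 * (q * p))%:R + 1 : R.
  have c0 : 0 < c by rewrite ltr_wpDl.
  have nearv : \forall v' \near v, forall j, `|v' j - v j| < e / c.
    refine (@filter_forall X J (fun j v' => `|v' j - v j| < e / c) _
      (nbhs_filter v) _) => j.
    have /cvgrPdist_lt /(_ _ (divr_gt0 e0 c0)) :=
      @proj_continuous J T j v : (v' j : R) @[v' --> v] --> (v j : R).
    by apply: filterS => v'; rewrite distrC.
  exists ([set v' | forall j, `|v' j - v j| < e / c], [set n | (n0 <= n)%N]).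
    by split => //=; exists n0.
  move=> [v' n] /= [near_v' n0n]; apply: Pn => //.
  apply: (@le_lt_trans _ _ (\sum_(i < p) \sum_(j < q) (e / c *+ 2))).
    apply: ler_sum => i _; apply: ler_sum => j _; rewrite !mxE.
    apply: le_trans (of_coords_lipschitz _ _ _ _) _.
    by rewrite mulr2n lerD // ltW.
  rewrite !sumr_const !card_ord -!mulrnA -mulr_natr mulrAC ltr_pdivrMr //.
  by rewrite ltr_pM2l // /c ltrDl.
move=> n _ boxP; exists n => A A1.
have /choice [f fP] : forall ij : 'I_p * 'I_q, exists ab : R * R,
    [/\ `|ab.1| <= 1, `|ab.2| <= 1 & A ij.1 ij.2 = of_coords ab.1 ab.2].
  move=> [i j]; have [a [b [a1 b1 Aab]]] := of_coords_onto (A i j).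
  have A1' := le_trans (modulus_le_entry_sum A i j) A1.
  by exists (a, b); split=> //; apply: le_trans A1'.
pose v : X := fun j : J => if j.2 then (f j.1).2 else (f j.1).1.
have <- : phi v = A.
  by apply/matrixP => i j; rewrite mxE /v /=; have [_ _ <-] := fP (i, j).
apply: boxP => //= -[ij b]; rewrite /v /= in_itv /= -ler_norml.
by have [? ? _] := fP ij; case: b.
Qed.

(** A norm is positive, hence locally bounded away from zero, on the compact
    unit sphere of [entry_sum].  As every seminorm is dominated by
    [entry_sum], all norms are equivalent. *)
Lemma entry_sum_le_norm (N : 'M[K]_(p, q) -> R) : is_norm N ->
  exists2 C, 0 < C & forall A, entry_sum A <= C * N A.
Proof.
move=> nN; have sN := norm_seminorm nN.
have [n nP] : exists n, forall A, entry_sum A <= 1 ->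
    entry_sum A = 1 -> 1 <= n.+1%:R * N A.
  apply: ball_uniform => A.
  have [->|A0] := eqVneq A 0.
    exists 1 => //; exists 0%N => n B _; rewrite subr0 => /lt_eqF + B1.
    by rewrite B1 eqxx.
  have [C C0 NC] := seminorm_le_entry_sum sN.
  have NA := norm_gt0 nN A0.
  (* On this ball around [A], [N] stays above half of [N A]. *)
  exists (N A / (2 * C)); first by rewrite divr_gt0 // mulr_gt0.
  exists (Num.bound (2 / N A)) => n B leBn BA _.
  have : N A / 2 <= N B.
    have := seminorm_sub_le sN A B; rewrite -[A - B]opprB (seminormN sN).
    have : C * entry_sum (B - A) <= N A / 2.
      by move: BA; rewrite ltr_pdivlMr ?mulr_gt0 // => BA; lra.
    by have := NC (B - A); lra.
  move=> AB; have bnd : 2 / N A <= n.+1%:R.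
    apply: le_trans (_ : (Num.bound (2 / N A))%:R <= _).
      by apply/ltW/archi_boundP; rewrite divr_ge0 // ltW.
    by rewrite ler_nat; apply: leq_trans leBn _.
  apply: le_trans (_ : n.+1%:R * (N A / 2) <= _); last by rewrite ler_wpM2l.
  by move: bnd; rewrite ler_pdivrMr //; lra.
exists n.+1%:R => // A; have [->|A0] := eqVneq A 0.
  by rewrite (seminorm0 sN) (seminorm0 entry_sum_seminorm) mulr0.
have SA := norm_gt0 entry_sum_norm A0.
have SA1 : entry_sum (of_real s (entry_sum A)^-1 *: A) = 1.
  rewrite (seminormZ entry_sum_seminorm) modulus_of_real ?invr_ge0 ?ltW //.
  by rewrite mulVf ?gt_eqF.
have := nP (of_real s (entry_sum A)^-1 *: A).
rewrite SA1 lexx => /(_ isT erefl).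
rewrite (seminormZ sN) modulus_of_real ?invr_ge0 ?(ltW SA) // mulrCA.
by rewrite ler_pdivlMl // mulr1.
Qed.

Lemma seminorm_le_norm (f N : 'M[K]_(p, q) -> R) :
  is_seminorm f -> is_norm N -> exists2 C, 0 < C & forall A, f A <= C * N A.
Proof.
move=> sf nN; have [C C0 fC] := seminorm_le_entry_sum sf.
have [D D0 ND] := entry_sum_le_norm nN.
exists (C * D) => [|A]; first by rewrite mulr_gt0.
by apply: le_trans (fC A) _; rewrite -mulrA ler_pM2l.
Qed.

End EntrySum.

(** * Growth rates of submultiplicative sequences *)

Section GrowthRate.
Context {R : realType}.
Implicit Types (a : nat -> R) (b c : R).

Lemma bernoulli_le (h : R) n : 0 <= h -> 1 + n%:R * h <= (1 + h) ^+ n.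
Proof.
move=> h0; elim: n => [|n IHn]; first by rewrite mul0r addr0 expr0.
rewrite exprS; apply: le_trans (_ : (1 + h) * (1 + n%:R * h) <= _).
  rewrite -natr1 mulrDl mul1r; have : 0 <= h * (n%:R * h) by rewrite !mulr_ge0.
  lra.
by rewrite ler_wpM2l // addr_ge0.
Qed.

(** A larger base absorbs every constant factor; this is how constants
    disappear when roots are taken. *)
Lemma geometric_dominates b b' c : 0 <= b -> b < b' ->
  \forall n \near \oo, c * b ^+ n <= b' ^+ n.
Proof.
rewrite le_eqVlt => /predU1P[<- b'0|b0 bb'].
  by exists 1%N => // -[//|n] _; rewrite expr0n /= mulr0 exprn_ge0 // ltW.
pose h := b' / b - 1.
have h0 : 0 < h by rewrite subr_gt0 ltr_pdivlMr ?mul1r.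
exists (Num.bound (`|c| / h)) => // n /= nC.
have -> : b' = b * (1 + h) by rewrite /h addrCA subrr addr0 mulrC divfK ?gt_eqF.
rewrite exprMn mulrC ler_pM2l ?exprn_gt0 //.
apply: le_trans (bernoulli_le _ (ltW h0)); apply: le_trans (ler_norm c) _.
have : `|c| / h < n%:R.
  apply: lt_le_trans (archi_boundP _) _; first by rewrite divr_ge0 // ltW.
  by rewrite ler_nat.
by rewrite ltr_pdivrMr //; lra.
Qed.

Lemma root_le a_k b k : (0 < k)%N -> 0 <= a_k -> 0 <= b ->
  (a_k `^ k%:R^-1 <= b) = (a_k <= b ^+ k).
Proof.
move=> k0 a0 b0; have kR : (k%:R : R) != 0 by rewrite pnatr_eq0 -lt0n.
apply/idP/idP => H.
  have -> : a_k = (a_k `^ k%:R^-1) ^+ k.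
    by rewrite -powR_mulrn ?powR_ge0 // -powRrM mulVf // powRr1.
  by rewrite lerXn2r // nnegrE ?powR_ge0.
have -> : b = (b ^+ k) `^ k%:R^-1.
  by rewrite -powR_mulrn // -powRrM mulfV // powRr1.
by rewrite ge0_ler_powR ?invr_ge0 // nnegrE exprn_ge0.
Qed.

Lemma root_gt b c k : (0 < k)%N -> 0 <= b -> b ^+ k < c ->
  exists2 t, b < t & t ^+ k < c.
Proof.
move=> k0 b0 bc; pose e := (b ^+ k + c) / 2; have bk0 := exprn_ge0 k b0.
have e0 : 0 <= e by rewrite /e; lra.
exists (e `^ k%:R^-1); first by rewrite ltNge root_le // -ltNge /e; lra.
rewrite -powR_mulrn ?powR_ge0 // -powRrM mulVf ?pnatr_eq0 -?lt0n // powRr1 //.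
by rewrite /e; lra.
Qed.

Definition submultiplicative a : Prop :=
  (forall k, 0 <= a k) /\ (forall j k, a (j + k)%N <= a j * a k).

(** Splitting [k] into a multiple of [n] and a remainder propagates the bound
    from the single index [n] to all indices. *)
Lemma submultiplicative_bound a b n : submultiplicative a -> 0 < b ->
  (0 < n)%N -> a n <= b ^+ n -> exists c, forall k, a k <= c * b ^+ k.
Proof.
move=> [a0 aM] b0 n0 an.
pose c := \sum_(r < n) a r / b ^+ r; exists (c * (1 + a 0%N)) => k.
have powq q : a (q * n)%N <= (1 + a 0%N) * b ^+ (q * n).
  elim: q => [|q IHq]; first by rewrite mul0n expr0 mulr1 lerDr.
  rewrite mulSn exprD mulrCA; apply: le_trans (aM _ _) _.
  by rewrite ler_pM.
have rem : a (k %% n)%N <= c * b ^+ (k %% n).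
  rewrite -ler_pdivrMr ?exprn_gt0 // /c.
  rewrite (bigD1 (Ordinal (ltn_pmod k n0))) //= lerDl.
  by apply: sumr_ge0 => i _; rewrite divr_ge0 // exprn_ge0 // ltW.
rewrite {1 2}(divn_eq k n) exprD; apply: le_trans (aM _ _) _.
apply: le_trans (ler_pM _ _ (powq _) rem) _ => //.
by rewrite mulrACA [(1 + _) * c]mulrC.
Qed.

(** Fekete's lemma in multiplicative form: the roots converge to their
    infimum.  Without it the limit defining the joint spectral radius would
    carry no information. *)
Lemma submultiplicative_root_cvg a : submultiplicative a ->
  cvgn (fun k => a k `^ k%:R^-1).
Proof.
move=> sub_a; have [a0 _] := sub_a.
pose roots := [set a k `^ k%:R^-1 | k in [set k | (0 < k)%N]].
have roots_inf : has_inf roots.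
  split; first by exists (a 1%N `^ 1^-1), 1%N.
  by exists 0 => _ [k _ <-]; exact: powR_ge0.
have inf0 : 0 <= inf roots.
  by apply: lb_le_inf; [case: roots_inf | move=> _ [k _ <-]; exact: powR_ge0].
apply/cvg_ex; exists (inf roots); apply/cvgrPdist_le => e e0.
have [_ [n /= n0 <-] nlt] := inf_adherent (divr_gt0 e0 (ltr0n _ 2)) roots_inf.
have b0 : 0 < inf roots + e / 2 by rewrite ltr_wpDl // divr_gt0.
have an : a n <= (inf roots + e / 2) ^+ n by rewrite -root_le // ltW.
have [c ac] := submultiplicative_bound sub_a b0 n0 an.
have near1 : \forall k \near \oo, (0 < k)%N by exists 1%N.
have lt_be : inf roots + e / 2 < inf roots + e by lra.
have geo := geometric_dominates c (ltW b0) lt_be.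
apply: filter_app near1; apply: filterS geo => k kc k0.
have : inf roots <= a k `^ k%:R^-1.
  by apply: ge_inf; [case: roots_inf | exists k].
have : a k `^ k%:R^-1 <= inf roots + e.
  by rewrite root_le //; [exact: le_trans (ac k) kc | lra].
by move=> ? ?; rewrite distrC ger0_norm; lra.
Qed.

Section Rate.
Variables (a : nat -> R) (sub_a : submultiplicative a).
Local Notation rate := (limn (fun k => a k `^ k%:R^-1)).

Lemma rate_ge0 : 0 <= rate.
Proof.
apply: limr_ge; first exact: submultiplicative_root_cvg.
by apply: nearW => k; exact: powR_ge0.
Qed.

Lemma rate_le b c : 0 <= b -> (forall k, a k <= c * b ^+ k) -> rate <= b.
Proof.
move=> b0 ab; apply/ler_addgt0Pr => e e0.
apply: limr_le; first exact: submultiplicative_root_cvg.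
have lt_be : b < b + e by rewrite ltrDl.
have near1 : \forall k \near \oo, (0 < k)%N by exists 1%N.
have [a0 _] := sub_a.
have geo := geometric_dominates c b0 lt_be.
apply: filter_app near1; apply: filterS geo => k kc k0.
by rewrite root_le //; [exact: le_trans (ab k) kc | lra].
Qed.

Lemma rate_lt_bound b : rate < b -> \forall k \near \oo, a k <= b ^+ k.
Proof.
move=> rb; have [a0 _] := sub_a.
have near1 : \forall k \near \oo, (0 < k)%N by exists 1%N.
have root_lt : \forall k \near \oo, a k `^ k%:R^-1 < b.
  exact: cvgr_lt (submultiplicative_root_cvg sub_a) _ rb.
apply: filter_app near1; apply: filterS root_lt => k /ltW + k0;
  rewrite root_le //.
exact: le_trans rate_ge0 (ltW rb).
Qed.

Lemma rate_ge b c : 0 < c -> 0 <= b ->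
  (forall l, exists2 k, (l <= k)%N & c * b ^+ k <= a k) -> b <= rate.
Proof.
move=> c0 b0 ab; rewrite leNgt; apply/negP => rb.
have rate0 := rate_ge0; pose b1 := (rate + b) / 2.
have rb1 : rate < b1 by rewrite /b1; lra.
have b1b : b1 < b by rewrite /b1; lra.
have b10 : 0 < b1 by rewrite /b1; lra.
have [l _ /= H] : \forall k \near \oo,
    a k <= b1 ^+ k /\ 2 / c * b1 ^+ k <= b ^+ k.
  apply: filter_app (rate_lt_bound rb1).
  by apply: filterS (geometric_dominates (2 / c) (ltW b10) b1b) => k.
have [k lk ak] := ab l; have [ab1 bb1] := H k lk.
have b1k : 0 < b1 ^+ k by rewrite exprn_gt0.
move: bb1; rewrite mulrAC ler_pdivrMr // => bb1.
have := le_trans ak ab1; lra.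
Qed.

End Rate.

Lemma rate_mono (a a' : nat -> R) : submultiplicative a ->
  submultiplicative a' ->
  (forall k, a k <= a' k) ->
  limn (fun k => a k `^ k%:R^-1) <= limn (fun k => a' k `^ k%:R^-1).
Proof.
move=> sub_a sub_a' aa'; have [a0 _] := sub_a; have [a'0 _] := sub_a'.
apply: ler_lim; [exact: submultiplicative_root_cvg..|].
by apply: nearW => k; apply: ge0_ler_powR => //; rewrite nnegrE.
Qed.

End GrowthRate.

(** * Operator norms and the joint spectral radius *)

Section JointSpectralRadius.
Context {R : realType} {s : scalar_kind} {d : nat}.
Local Notation K := (base_field R s).

Lemma entry_sumM p q r (A : 'M[K]_(p, q)) (B : 'M[K]_(q, r)) :
  entry_sum (A *m B) <= entry_sum A * entry_sum B.
Proof.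
rewrite {1 2}/entry_sum mulr_suml; apply: ler_sum => i _.
rewrite mulr_suml.
apply: le_trans (_ : \sum_j \sum_k modulus (A i j) * modulus (B j k) <= _).
  rewrite exchange_big /=; apply: ler_sum => k _; rewrite mxE.
  elim/big_ind2: _ => [|x a y b xa yb|j _]; first by rewrite modulus0.
    exact: le_trans (modulusD _ _) (lerD xa yb).
  by rewrite modulusM.
apply: ler_sum => j _; rewrite -mulr_sumr ler_wpM2l ?modulus_ge0 //.
rewrite /entry_sum [leRHS](bigD1 j) //= lerDl.
by apply: sumr_ge0 => *; apply: sumr_ge0 => *; exact: modulus_ge0.
Qed.

Definition entry_bounded (M : set 'M[K]_d) : Prop :=
  exists C : R, forall A, M A -> entry_sum A <= C.

Lemma compact_entry_bounded (M : set 'M[K]_d) : compact M -> entry_bounded M.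
Proof.
move=> /compact_near_coveringP cov.
have [] : \forall n \near \oo, M `<=` (fun A => entry_sum A <= n%:R).
  apply: cov => A _.
  exists ([set B | ball A 1 B],
      [set n | (Num.bound (entry_sum A + \sum_(i < d) \sum_(j < d) 1) <= n)%N]).
    split; first exact: nbhsx_ballx.
    by exists (Num.bound (entry_sum A + \sum_(i < d) \sum_(j < d) 1)).
  move=> [B n] /= [AB An].
  have ABd : entry_sum (B - A) <= \sum_(i < d) \sum_(j < d) 1.
    apply: ler_sum => i _; apply: ler_sum => j _; rewrite -modulusN !mxE opprB.
    by apply/ltW/modulus_lt1; case: AB => _ /(_ i j).
  have := seminormD entry_sum_seminorm A (B - A); rewrite addrC subrK.
  move=> /le_trans; apply.
  apply: le_trans (_ : entry_sum A + \sum_(i < d) \sum_(j < d) 1 <= _).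
    by rewrite lerD2l.
  apply: le_trans
    (_ : (Num.bound (entry_sum A + \sum_(i < d) \sum_(j < d) 1))%:R <= _);
    last by rewrite ler_nat.
  apply/ltW/archi_boundP/addr_ge0;
    first exact: seminorm_ge0 entry_sum_seminorm _.
  by apply: sumr_ge0 => *; apply: sumr_ge0.
by move=> n _ /(_ n (leqnn n)) Mn; exists n%:R.
Qed.

Lemma products0 (M : set 'M[K]_d) S : products 0 M S <-> S = 1.
Proof.
split=> [[A _ <-]|->]; first by rewrite big_ord0.
by exists (fun=> 0); [case | rewrite big_ord0].
Qed.

(** Peeling off the factor that acts first on a vector; the algebra of
    products is obtained from this recursion. *)
Lemma productsSr (M : set 'M[K]_d) k S : products k.+1 M S <->
  exists T A, [/\ products k M T, M A & S = T * A].
Proof.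
split=> [[A MA <-]|[T [A [[B MB <-] MA ->]]]].
  exists (\prod_(j < k) A (lift ord0 (rev_ord j))), (A ord0); split=> //.
    by exists (A \o lift ord0) => // j; exact: MA.
  rewrite big_ord_recr /=; congr (_ * A _); last first.
    by apply: val_inj; rewrite /= subnn.
  apply: eq_bigr => j _; congr (A _); apply: val_inj => /=.
  by rewrite /bump /= add1n subnSK // subSS; have := ltn_ord j; lia.
exists (fun i => if unlift ord0 i is Some j then B j else A).
  by move=> j; case: unliftP => [i|] _ /=.
rewrite big_ord_recr /=; congr (_ * _).
  apply: eq_bigr => j _.
  have -> : rev_ord (widen_ord (leqnSn k) j) = lift ord0 (rev_ord j).
    apply: val_inj => /=.
    by rewrite /bump /= add1n subSS; have := ltn_ord j; lia.
  by rewrite liftK.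
have -> : rev_ord (@ord_max k) = ord0 by apply: val_inj; rewrite /= subnn.
by rewrite unlift_none.
Qed.

Lemma productsM (M : set 'M[K]_d) j k S T :
  products j M S -> products k M T -> products (j + k) M (S * T).
Proof.
move=> MS; elim: k T => [|k IHk] T.
  by move=> /products0 ->; rewrite mulr1 addn0.
move=> /productsSr[T' [A [MT' MA ->]]]; rewrite addnS mulrA.
by apply/productsSr; exists (S * T'), A; split=> //; exact: IHk.
Qed.

Lemma products_split (M : set 'M[K]_d) j k U : products (j + k) M U ->
  exists S T, [/\ products j M S, products k M T & U = S * T].
Proof.
elim: k U => [|k IHk] U.
  by rewrite addn0 => MU; exists U, 1; split; [|exact/products0|rewrite mulr1].
rewrite addnS => /productsSr[U' [A [/IHk[S [T [MS MT ->]]] MA ->]]].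
exists S, (T * A); split; rewrite ?mulrA //.
by apply/productsSr; exists T, A.
Qed.

Lemma products_sub (M M' : set 'M[K]_d) k :
  M `<=` M' -> products k M `<=` products k M'.
Proof. by move=> MM' _ [A MA <-]; exists A => // j; exact/MM'/MA. Qed.

Lemma products_neq0 (M : set 'M[K]_d) k : M !=set0 -> products k M !=set0.
Proof. by move=> [A MA]; eexists; exists (fun=> A). Qed.

Lemma products_invariant (M : set 'M[K]_d) (W : {vspace 'cV[K]_d}) k S x :
  invariant_subspace M W -> products k M S -> x \in W -> S *m x \in W.
Proof.
move=> invW; elim: k S x => [|k IHk] S x.
  by move=> /products0 ->; rewrite mul1mx.
move=> /productsSr[T [A [MT MA ->]]] Wx; rewrite -mulmxA.
by apply: IHk => //; exact: invW.
Qed.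

Variables (nu : 'cV[K]_d -> R) (nu_norm : is_norm nu).
Let nu_seminorm := norm_seminorm nu_norm.
Local Notation opnorm := (operator_norm nu).

Lemma action_bounded :
  exists2 C, 0 < C & forall A x, nu (A *m x) <= C * entry_sum A * nu x.
Proof.
have [C C0 nuC] := seminorm_le_entry_sum nu_seminorm.
have [D D0 Dnu] := entry_sum_le_norm nu_norm.
exists (C * D) => [|A x]; first by rewrite mulr_gt0.
apply: le_trans (nuC _) _; rewrite -!mulrA ler_pM2l // mulrCA.
apply: le_trans (entry_sumM _ _) _.
by rewrite ler_wpM2l // (seminorm_ge0 entry_sum_seminorm).
Qed.

Lemma operator_norm_set_sup A :
  has_sup [set nu (A *m x) | x in [set x | nu x <= 1]].
Proof.
split; first by exists (nu (A *m 0)), 0 => //=; rewrite (seminorm0 nu_seminorm).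
have [C C0 nuC] := action_bounded.
exists (C * entry_sum A) => _ [x /= x1 <-]; apply: le_trans (nuC A x) _.
by rewrite ler_piMr // mulr_ge0 ?(ltW C0) // (seminorm_ge0 entry_sum_seminorm).
Qed.

Lemma operator_norm_ge0 A : 0 <= opnorm A.
Proof.
apply: le_trans (_ : nu (A *m 0) <= _); first exact: seminorm_ge0 nu_seminorm _.
apply: sup_upper_bound; first exact: operator_norm_set_sup.
by exists 0 => //=; rewrite (seminorm0 nu_seminorm).
Qed.

Lemma operator_normP A x : nu (A *m x) <= opnorm A * nu x.
Proof.
have [->|x0] := eqVneq x 0.
  by rewrite mulmx0 (seminorm0 nu_seminorm) mulr0.
have nx := norm_gt0 nu_norm x0;
  have nx' : 0 <= (nu x)^-1 by rewrite invr_ge0 ltW.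
rewrite -ler_pdivrMr // mulrC -[(nu x)^-1](@modulus_of_real _ s) //.
rewrite -(seminormZ nu_seminorm) scalemxAr; apply: sup_upper_bound.
  exact: operator_norm_set_sup.
exists (of_real s (nu x)^-1 *: x) => //=.
by rewrite (seminormZ nu_seminorm) modulus_of_real // mulVf ?gt_eqF.
Qed.

Lemma operator_norm_le A c :
  0 <= c -> (forall x, nu (A *m x) <= c * nu x) -> opnorm A <= c.
Proof.
move=> c0 Ac; apply: ge_sup; first by case: (operator_norm_set_sup A).
by move=> _ [x /= x1 <-]; apply: le_trans (Ac x) _; rewrite ler_piMr.
Qed.

Lemma operator_normM A B : opnorm (A *m B) <= opnorm A * opnorm B.
Proof.
apply: operator_norm_le => [|x]; first by rewrite mulr_ge0 ?operator_norm_ge0.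
rewrite -mulmxA -mulrA; apply: le_trans (operator_normP _ _) _.
by rewrite ler_wpM2l ?operator_norm_ge0 ?operator_normP.
Qed.

Definition max_growth (M : set 'M[K]_d) k : R :=
  sup [set opnorm S | S in products k M].

Lemma max_growth_has_sup (M : set 'M[K]_d) k : M !=set0 -> entry_bounded M ->
  has_sup [set opnorm S | S in products k M].
Proof.
move=> M0 [B MB]; split.
  by have [S MS] := products_neq0 k M0; exists (opnorm S), S.
have [C C0 nuC] := action_bounded.
exists ((C * `|B|) ^+ k) => _ [S MS <-].
apply: operator_norm_le; first by rewrite exprn_ge0 // mulr_ge0 // ltW.
elim: k S MS => [|k IHk] S.
  by move=> /products0 -> x; rewrite expr0 mul1r mul1mx.
move=> /productsSr[T [A [MT MA ->]]] x.
rewrite -mulmxA exprSr -mulrA; apply: le_trans (IHk T MT _) _.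
rewrite ler_wpM2l //; first by rewrite exprn_ge0 // mulr_ge0 // ltW.
apply: le_trans (nuC A x) _; rewrite ler_wpM2r ?(seminorm_ge0 nu_seminorm) //.
by rewrite ler_pM2l //; apply: le_trans (MB A MA) (ler_norm B).
Qed.

Section MaxGrowth.
Variables (M : set 'M[K]_d) (M0 : M !=set0) (Mb : entry_bounded M).

Lemma operator_norm_le_max_growth k S :
  products k M S -> opnorm S <= max_growth M k.
Proof.
move=> MS; apply: sup_upper_bound; first exact: max_growth_has_sup.
by exists S.
Qed.

Lemma max_growth_le k c :
  (forall S, products k M S -> opnorm S <= c) -> max_growth M k <= c.
Proof.
move=> Mc; apply: ge_sup; first by case: (max_growth_has_sup k M0 Mb).
by move=> _ [S MS <-]; exact: Mc.
Qed.

Lemma max_growth_submultiplicative : submultiplicative (max_growth M).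
Proof.
split=> [k|j k].
  have [S MS] := products_neq0 k M0.
  exact: le_trans (operator_norm_ge0 S) (operator_norm_le_max_growth MS).
apply: max_growth_le => _ /products_split[S [T [MS MT ->]]].
apply: le_trans (operator_normM S T) _.
by rewrite ler_pM ?operator_norm_ge0 ?operator_norm_le_max_growth.
Qed.

Lemma jsr_ge0 : 0 <= joint_spectral_radius nu M.
Proof. exact: rate_ge0 max_growth_submultiplicative. Qed.

(** Along a product the factors [b] multiply up; comparing [h] with [nu] costs
    a constant, which disappears in the limit. *)
Lemma jsr_le (h : 'cV[K]_d -> R) b : is_norm h -> 0 <= b ->
  (forall A x, M A -> h (A *m x) <= b * h x) ->
  joint_spectral_radius nu M <= b.
Proof.
move=> h_norm b0 hM; have h_sn := norm_seminorm h_norm.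
have [C C0 nuC] := seminorm_le_norm nu_seminorm h_norm.
have [D D0 Dnu] := seminorm_le_norm h_sn nu_norm.
apply: (rate_le max_growth_submultiplicative b0 (c := C * D)) => k.
apply: max_growth_le => S MS.
have hS x : h (S *m x) <= b ^+ k * h x.
  elim: k S MS x => [|k IHk] S.
    by move=> /products0 -> x; rewrite expr0 mul1r mul1mx.
  move=> /productsSr[T [A [MT MA ->]]] x; rewrite -mulmxA exprSr -mulrA.
  by apply: le_trans (IHk T MT _) _; rewrite ler_wpM2l ?exprn_ge0 ?hM.
apply: operator_norm_le => [|x].
  by rewrite !mulr_ge0 ?exprn_ge0 ?(ltW C0) ?(ltW D0).
apply: le_trans (nuC _) _; rewrite -!mulrA ler_pM2l //.
apply: le_trans (hS x) _; rewrite mulrCA.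
by rewrite ler_wpM2l ?exprn_ge0.
Qed.

(** As the limit exists, a subsequence of lengths suffices for a lower bound:
    this is what iterated expansion of a vector provides. *)
Lemma jsr_ge x b c : x != 0 -> 0 < c -> 0 <= b ->
  (forall l, exists k S, [/\ (l <= k)%N, products k M S &
     c * b ^+ k <= nu (S *m x)]) ->
  b <= joint_spectral_radius nu M.
Proof.
move=> x0 c0 b0 large; have nx := norm_gt0 nu_norm x0.
apply: (rate_ge max_growth_submultiplicative (divr_gt0 c0 nx) b0) => l.
have [k [S [lk MS cS]]] := large l; exists k => //.
rewrite mulrAC ler_pdivrMr //; apply: le_trans cS _.
apply: le_trans (operator_normP S x) _.
by rewrite ler_pM2r // operator_norm_le_max_growth.
Qed.

End MaxGrowth.

Lemma jsr_mono (M M' : set 'M[K]_d) : M !=set0 -> entry_bounded M' ->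
  M `<=` M' -> joint_spectral_radius nu M <= joint_spectral_radius nu M'.
Proof.
move=> M0 Mb' MM'.
have Mb : entry_bounded M by case: Mb' => C MC; exists C => A /MM'; exact: MC.
have M0' : M' !=set0 by case: M0 => A /MM'; exists A.
apply: rate_mono; try exact: max_growth_submultiplicative.
move=> k; apply: max_growth_le => // S MS.
by apply: operator_norm_le_max_growth => //; exact: products_sub MS.
Qed.

End JointSpectralRadius.

(** * The extremal seminorm of a flag step *)

(** A subspace of maximal dimension among those contained in the set is the
    whole set. *)
Lemma vspace_of_closed (K : fieldType) (vT : vectType K) (P : vT -> Prop) :
  P 0 -> (forall (a : K) x y, P x -> P y -> P (a *: x + y)) ->
  exists L : {vspace vT}, forall x, x \in L <-> P x.
Proof.
move=> P0 Plin.
pose inP (L : {vspace vT}) := forall x, x \in L -> P x.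
pose Q n := `[< exists2 L, \dim L = n & inP L >].
have exQ : exists n, Q n.
  by exists 0%N; apply/asboolP; exists 0%VS => [|x /[!memv0]/eqP->];
    rewrite ?dimv0.
have ubQ n : Q n -> (n <= \dim {:vT})%N.
  by move=> /asboolP[L <- _]; apply: dimvS; exact: subvf.
case: (ex_maxnP exQ ubQ) => n /asboolP[L dimL LP] maxL.
exists L => x; split; first exact: LP.
move=> Px; apply: contrapT => /negP nLx.
have : Q (\dim (L + <[x]>)%VS).
  apply/asboolP; exists (L + <[x]>)%VS =>
    // _ /memv_addP[y Ly [_ /vlineP[a ->] ->]].
  by rewrite addrC; apply: Plin => //; exact: LP.
move=> /maxL; rewrite -dimL leqNgt => /negP; apply.
rewrite ltn_neqAle dimvS ?addvSl // andbT; apply: contra nLx => /eqP dimE.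
have /eqP -> : L == (L + <[x]>)%VS by rewrite eqEdim addvSl -dimE leqnn.
by rewrite memvE addvSr.
Qed.

(** Throughout, [W] is maximal among the proper invariant subspaces of the
    invariant subspace [U], and [P] induces a projector of [U] along [W].  The
    map sending [x] to [nu (P x)] is then a norm on the quotient of [U] by [W],
    on which [M] acts irreducibly; working with [P] avoids forming the
    quotient. *)
Section FlagStep.
Context {R : realType} {s : scalar_kind} {d : nat}.
Local Notation K := (base_field R s).
Variables (nu : 'cV[K]_d -> R) (nu_norm : is_norm nu).
Variables (M : set 'M[K]_d) (M0 : M !=set0) (Mb : entry_bounded M).
Variables (W U : {vspace 'cV[K]_d}).
Hypotheses (invW : invariant_subspace M W) (invU : invariant_subspace M U).
Hypotheses (WU : (W <= U)%VS) (W_neq_U : W != U).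
Hypothesis irred : forall L, invariant_subspace M L ->
  (W <= L)%VS -> (L <= U)%VS -> L = W \/ L = U.
Variable P : 'End('cV[K]_d).
Hypotheses (P_W : forall x, x \in W -> P x = 0)
  (P_U : forall x, x \in U -> x - P x \in W).
Local Notation rho := (joint_spectral_radius nu M).
Let nu_sn := norm_seminorm nu_norm.
Let rho_ge0 : 0 <= rho := jsr_ge0 nu_norm M0 Mb.

Lemma step_memU x : x \in U -> P x \in U.
Proof.
move=> Ux; rewrite -[P x](subKr x) rpredB //.
exact: subvP WU _ (P_U Ux).
Qed.

Lemma step_idem x : x \in U -> P (P x) = P x.
Proof.
by move=> Ux; apply/esym/eqP; rewrite -subr_eq0 -linearB; apply/eqP/P_W/P_U.
Qed.

Lemma step_mem x : x \in U -> P x = 0 -> x \in W.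
Proof. by move=> Ux Px; have := P_U Ux; rewrite Px subr0. Qed.

Lemma step_product k S x : products k M S -> x \in U ->
  P (S *m P x) = P (S *m x).
Proof.
move=> MS Ux; apply/esym/eqP; rewrite -subr_eq0 -linearB -mulmxBr; apply/eqP.
by apply: P_W; apply: products_invariant MS (P_U Ux).
Qed.

Lemma action_seminorm (S : 'M[K]_d) (Q : 'End('cV[K]_d)) :
  is_seminorm (fun x => nu (P (S *m Q x))).
Proof.
apply: (@seminorm_comp _ _ _ _ (fun x => P (S *m Q x))) => // a x y.
by rewrite linearP mulmxDr -scalemxAr linearP.
Qed.

(** If every vector of [U] outside [W] were expanded modulo [W] by more than
    [rho ^ k], compactness of the unit sphere of a complement of [W] would
    make the expansion rate uniform, and iterating it would produce a joint
    spectral radius larger than [rho]. *)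
Lemma nonexpanded_vector : exists x, [/\ x \in U, P x != 0 &
  forall k S, products k M S -> nu (P (S *m x)) <= rho ^+ k * nu (P x)].
Proof.
apply: contrapT => noex.
have expand x : x \in U -> P x != 0 -> exists k S,
    products k M S /\ rho ^+ k * nu (P x) < nu (P (S *m x)).
  move=> Ux Px; apply: contrapT => nex; apply: noex; exists x;
    split=> // k S MS.
  by rewrite leNgt; apply/negP => lt; apply: nex; exists k, S.
(* The fixed vectors of [T] form the complement of [W] in [U] given by [P]. *)
pose T : 'End('cV[K]_d) := (P \o projv U)%VF.
have TE x : T x = P (projv U x) by rewrite comp_lfunE.
have T_mem x : T x = x -> x \in U.
  by rewrite TE => <-; exact/step_memU/memv_proj.
have T_P x : T x = x -> P x = x.
  by move=> Tx; rewrite -{1}Tx TE step_idem ?memv_proj // -TE.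
have P_T x : x \in U -> T (P x) = P x.
  by move=> Ux; rewrite TE projv_id ?step_memU // step_idem.
have [n nP] : exists n, forall x, entry_sum x <= 1 -> entry_sum x = 1 ->
    T x = x -> exists k S, [/\ (0 < k)%N, products k M S &
      (rho + n.+1%:R^-1) ^+ k * nu x <= nu (P (S *m x))].
  apply: ball_uniform => x.
  have [->|x0] := eqVneq x 0.
    exists 1 => //; exists 0%N => n B _; rewrite subr0 => /lt_eqF + B1.
    by rewrite B1 eqxx.
  (* The complement is closed: near a vector outside it, nothing to show. *)
  have [Tx|Tx] := eqVneq (T x) x; last first.
    pose f (y : 'cV[K]_d) := entry_sum (y - T y).
    have sf : is_seminorm f.
      apply: (@seminorm_comp _ _ _ _ (fun y => y - T y) _ _ entry_sum_seminorm).
      by move=> a y z; rewrite linearP opprD addrACA scalerBr.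
    have fx : 0 < f x.
      by apply: (norm_gt0 entry_sum_norm); rewrite subr_eq0 eq_sym.
    have [e e0 fe] := seminorm_gt0_near sf fx.
    exists e => //; exists 0%N => n y _ /fe + _ Ty.
    by rewrite /f Ty subrr (seminorm0 entry_sum_seminorm) ltxx.
  have Ux := T_mem _ Tx; have Px := T_P _ Tx.
  have [|k [S [MS expS]]] := expand x Ux; first by rewrite Px.
  rewrite Px in expS; have nx := norm_gt0 nu_norm x0.
  have k0 : (0 < k)%N.
    case: k MS expS => // /products0 ->.
    by rewrite expr0 mul1r mul1mx Px ltxx.
  have [|t rt tx] := root_gt (c := nu (P (S *m x)) / nu x) k0 rho_ge0.
    by rewrite ltr_pdivlMr.
  move: tx; rewrite ltr_pdivlMr // => tx.
  have sPS : is_seminorm (fun y => nu (P (S *m y))).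
    by have [a b] := action_seminorm S \1%VF; split=> [c y|y z];
       [have := a c y|have := b y z]; rewrite !id_lfunE.
  (* The strict expansion at rate [t] persists for [y] so close to [x] that
     the Lipschitz bounds of the two sides do not exhaust the slack. *)
  have [C C0 PSC] := seminorm_le_entry_sum sPS.
  have [D D0 nuD] := seminorm_le_entry_sum nu_sn.
  have tk0 : 0 <= t ^+ k by rewrite exprn_ge0 // ltW // (le_lt_trans rho_ge0).
  have c0 : 0 < C + t ^+ k * D by rewrite ltr_pwDl // mulr_ge0 // ltW.
  exists ((nu (P (S *m x)) - t ^+ k * nu x) / (C + t ^+ k * D)).
    by rewrite divr_gt0 // subr_gt0.
  exists (Num.bound (t - rho)^-1) => n y le_n;
    rewrite ltr_pdivlMr // => yx _ Ty.
  exists k, S; split=> //.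
  have n_t : rho + n.+1%:R^-1 <= t.
    rewrite -lerBrDl -[leRHS]invrK lef_pV2 ?posrE ?invr_gt0 ?subr_gt0 //.
    apply: le_trans (_ : (Num.bound (t - rho)^-1)%:R <= _).
      by apply/ltW/archi_boundP; rewrite invr_ge0 subr_ge0 ltW.
    by rewrite ler_nat; apply: leq_trans le_n _.
  apply: le_trans (_ : t ^+ k * nu y <= _).
    rewrite ler_wpM2r ?(seminorm_ge0 nu_sn) // lerXn2r // nnegrE.
      by rewrite addr_ge0 ?invr_ge0.
    by rewrite ltW // (le_lt_trans rho_ge0).
  have h1 : nu (P (S *m x)) - nu (P (S *m y)) <= C * entry_sum (y - x).
    apply: le_trans (seminorm_sub_le sPS x y) _.
    by rewrite -[x - y]opprB (seminormN sPS); exact: PSC.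
  have h2 : t ^+ k * nu y - t ^+ k * nu x <= t ^+ k * D * entry_sum (y - x).
    rewrite -mulrBr -mulrA ler_wpM2l //.
    exact: le_trans (seminorm_sub_le nu_sn y x) (nuD _).
  lra.
pose t := rho + n.+1%:R^-1.
have t0 : 0 < t by rewrite ltr_wpDl // invr_gt0.
have uniform x : x != 0 -> T x = x ->
  exists k S, [/\ (0 < k)%N, products k M S &
    t ^+ k * nu x <= nu (P (S *m x))].
  move=> x0 Tx; have ex := norm_gt0 entry_sum_norm x0.
  have ex' : 0 < (entry_sum x)^-1 by rewrite invr_gt0.
  pose y := of_real s (entry_sum x)^-1 *: x.
  have ey : entry_sum y = 1.
    rewrite (seminormZ entry_sum_seminorm) modulus_of_real ?(ltW ex') //.
    by rewrite mulVf ?gt_eqF.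
  have [||k [S [k0 MS]]] := nP y _ ey; first by rewrite ey.
    by rewrite linearZ /= Tx.
  rewrite -scalemxAr linearZ /= !(seminormZ nu_sn).
  rewrite modulus_of_real ?(ltW ex') // mulrCA ler_pM2l // => St.
  by exists k, S.
have [u Uu Wu] : exists2 u, u \in U & u \notin W.
  apply: contrapT => nex; move/negP: W_neq_U; apply; rewrite eqEsubv WU /=.
  apply/subvP => u Uu; apply: contrapT => /negP Wu; apply: nex.
  by exists u.
have x0 : P u != 0 by apply: contra Wu => /eqP; exact: step_mem.
have nx := norm_gt0 nu_norm x0.
have sP : is_seminorm (fun y => nu (P y)).
  by apply: (@seminorm_comp _ _ _ _ P) => // a y z; rewrite linearP.
have [D D0 PD] := seminorm_le_norm sP nu_norm.
suff : t <= rho by rewrite gerDl leNgt invr_gt0 ltr0n.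
apply: (jsr_ge nu_norm M0 Mb x0 (divr_gt0 nx D0) (ltW t0)) => l.
suff [k [S [lk MS tS]]] : exists k S, [/\ (l <= k)%N, products k M S &
    t ^+ k * nu (P u) <= nu (P (S *m P u))].
  exists k, S; split=> //; rewrite mulrAC ler_pdivrMr // mulrC.
  by apply: le_trans tS _; rewrite [leRHS]mulrC; exact: PD.
have UPu := step_memU Uu.
(* The vector reached is projected back to the complement and expanded again;
   the projection changes it by an element of [W], invisible to [P]. *)
elim: l => [|l [k [S [lk MS tS]]]].
  exists 0%N, 1; split=> //; first exact/products0.
  by rewrite expr0 mul1r mul1mx step_idem.
have USu : S *m P u \in U by exact: products_invariant MS UPu.
have [||k' [S' [k'0 MS' tS']]] := uniform (P (S *m P u)).
- apply/eqP => PS0; move: tS; rewrite PS0 (seminorm0 nu_sn) leNgt.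
  by rewrite mulr_gt0 ?exprn_gt0.
- exact: P_T.
exists (k' + k)%N, (S' * S); split;
  [by rewrite -add1n leq_add|exact: productsM|].
rewrite exprD -mulrA -mulmxA -(step_product MS' USu).
by apply: le_trans tS'; rewrite ler_wpM2l // exprn_ge0 // ltW.
Qed.

(** The vectors of [U] with bounded normalised orbit modulo [W] form an
    invariant subspace, which by irreducibility is all of [U]. *)
Lemma orbits_bounded : exists2 C, 0 < C &
  forall k S x, products k M S -> x \in U ->
    nu (P (S *m x)) <= C * rho ^+ k * nu x.
Proof.
have [x [Ux Px bnd_x]] := nonexpanded_vector.
pose bnd y := y \in U /\ exists C, forall k S, products k M S ->
  nu (P (S *m y)) <= C * rho ^+ k.
have rk0 k : 0 <= rho ^+ k by exact: exprn_ge0.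
have [L LE] : exists L : {vspace 'cV[K]_d}, forall y, y \in L <-> bnd y.
  apply: vspace_of_closed.
    split; first exact: mem0v.
    by exists 0 => k S _; rewrite mulmx0 linear0 (seminorm0 nu_sn) mul0r.
  move=> a y z [Uy [C yC]] [Uz [D zD]]; split; first by rewrite memvD ?memvZ.
  exists (modulus a * C + D) => k S MS.
  rewrite mulmxDr -scalemxAr linearP; apply: le_trans (seminormD nu_sn _ _) _.
  rewrite (seminormZ nu_sn) mulrDl lerD ?zD // -mulrA.
  by rewrite ler_wpM2l ?modulus_ge0 // yC.
have invL : invariant_subspace M L.
  move=> A MA y /LE[Uy [C yC]]; apply/LE; split; first exact: invU.
  exists (C * rho) => k S MS; rewrite mulmxA -mulrA -exprS; apply: yC.
  by apply/productsSr; exists S, A.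
have WL : (W <= L)%VS.
  apply/subvP => y Wy; apply/LE; split; first exact: subvP WU y Wy.
  exists 0 => k S MS; rewrite P_W ?(seminorm0 nu_sn) ?mul0r //.
  exact: products_invariant MS Wy.
have LU : (L <= U)%VS by apply/subvP => y /LE[].
have Lx : x \in L.
  apply/LE; split=> //; exists (nu (P x)) => k S MS; rewrite mulrC;
    exact: bnd_x.
have LeqU : L = U.
  have [LW|//] := irred invL WL LU; case/negP: Px; apply/eqP/P_W.
  by rewrite -LW.
have /choice [C CP] : forall i : 'I_d, exists C, forall k S, products k M S ->
    nu (P (S *m projv U (delta_mx i 0))) <= C * rho ^+ k.
  move=> i; have : projv U (delta_mx i 0) \in L by rewrite LeqU memv_proj.
  by move=> /LE[_ [C HC]]; exists C.
have [D D0 nuD] := entry_sum_le_norm nu_norm.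
pose B := 1 + \sum_i `|C i|.
have B0 : 0 < B by rewrite ltr_pwDl // sumr_ge0.
exists (B * D) => [|k S y MS Uy]; first by rewrite mulr_gt0.
rewrite -[y in S *m y](projv_id Uy).
apply: le_trans (_ : B * rho ^+ k * entry_sum y <= _).
  apply: (seminorm_le_of_delta (action_seminorm S (projv U))) => i j.
  rewrite (ord1 j); apply: le_trans (CP i k S MS) _; rewrite ler_wpM2r //.
  apply: le_trans (ler_norm _) _; rewrite /B (bigD1 i) //= addrCA lerDl.
  by rewrite addr_ge0 // sumr_ge0.
rewrite -!mulrA ler_pM2l // [leRHS]mulrCA.
by rewrite ler_wpM2l // nuD.
Qed.

(** The supremum over all products of the normalised size of the orbit modulo
    [W] is a seminorm that no matrix of [M] expands by more than [rho].  When
    [rho] is zero, the junk value of the inverse of zero leaves only the empty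
    product in the supremum, and the bound above says that [M] maps [U] into
    [W]. *)
Lemma extremal_seminorm : exists p : 'cV[K]_d -> R,
  [/\ is_seminorm p, forall x, x \in W -> p x = 0,
      forall x, x \in U -> nu (P x) <= p x &
      forall A x, M A -> x \in U -> p (A *m x) <= rho * p x].
Proof.
have [C C0 orb] := orbits_bounded.
have rk0 k : 0 <= rho ^+ k by exact: exprn_ge0.
pose Q := projv U.
pose orbit x := [set r | exists k S,
  products k M S /\ r = nu (P (S *m Q x)) / rho ^+ k].
have orbit_sup x : has_sup (orbit x).
  split.
    exists (nu (P (1 *m Q x)) / rho ^+ 0), 0%N, 1; split=> //.
    exact/products0.
  exists (C * nu (Q x)) => _ [k [S [MS ->]]].
  have := orb k S (Q x) MS (memv_proj _ _).
  have [-> _|rk] := eqVneq (rho ^+ k) 0.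
    by rewrite invr0 mulr0 mulr_ge0 ?(ltW C0) // (seminorm_ge0 nu_sn).
  by rewrite ler_pdivrMr 1?mulrAC // lt_neqAle eq_sym rk rk0.
pose p x := sup (orbit x).
have p_ub x k S : products k M S -> nu (P (S *m Q x)) / rho ^+ k <= p x.
  by move=> MS; apply: sup_upper_bound (orbit_sup x) _ _; exists k, S.
have p_le x c : (forall k S, products k M S ->
    nu (P (S *m Q x)) / rho ^+ k <= c) -> p x <= c.
  move=> xc; apply: ge_sup; first by case: (orbit_sup x).
  by move=> _ [k [S [MS ->]]]; exact: xc.
have p_ge0 x : 0 <= p x.
  apply: le_trans (p_ub x 0%N 1 _); last exact/products0.
  by rewrite divr_ge0 // (seminorm_ge0 nu_sn).
have p_Zle a x : p (a *: x) <= modulus a * p x.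
  apply: p_le => k S MS.
  rewrite (seminormZ (action_seminorm S Q)) -mulrA.
  by rewrite ler_wpM2l ?modulus_ge0 ?p_ub.
exists p; split.
- split=> [a x|x y].
    apply/eqP; rewrite eq_le p_Zle /=.
    have [->|a0] := eqVneq a 0; first by rewrite modulus0 mul0r.
    have ma : 0 < modulus a.
      by rewrite lt_neqAle eq_sym modulus_eq0 a0 modulus_ge0.
    rewrite -ler_pdivlMl //.
    have <- : modulus a^-1 = (modulus a)^-1.
      by apply: (mulfI (lt0r_neq0 ma));
        rewrite -modulusM mulfV // modulus1 mulfV // lt0r_neq0.
    by rewrite -{1}[x](scalerK a0).
  apply: p_le => k S MS.
  apply: le_trans (_ : (nu (P (S *m Q x)) + nu (P (S *m Q y))) / rho ^+ k <= _).
    rewrite ler_wpM2r ?invr_ge0 //; exact: seminormD (action_seminorm S Q) x y.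
  by rewrite mulrDl lerD ?p_ub.
- move=> x Wx; apply/eqP; rewrite eq_le p_ge0 andbT; apply: p_le => k S MS.
  rewrite /Q projv_id ?(subvP WU) //.
  rewrite P_W ?(seminorm0 nu_sn) ?mul0r //; exact: products_invariant MS Wx.
- move=> x Ux; apply: le_trans (p_ub x 0%N 1 _); last exact/products0.
  by rewrite expr0 divr1 mul1mx /Q projv_id.
move=> A x MA Ux; apply: p_le => k S MS; rewrite /Q projv_id; last exact: invU.
have MSA : products k.+1 M (S * A) by apply/productsSr; exists S, A.
rewrite mulmxA; have [r0|r0] := eqVneq rho 0.
  have := orb _ _ x MSA Ux; rewrite r0 expr0n /= mulr0 mul0r mul0r => nu0.
  have -> : nu (P (S *m A *m x)) = 0.
    by apply/eqP; rewrite eq_le nu0 (seminorm_ge0 nu_sn).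
  by rewrite mul0r.
have rp : 0 < rho by rewrite lt_neqAle eq_sym r0 rho_ge0.
have := p_ub x _ _ MSA; rewrite /Q projv_id // exprS invfM mulrCA.
by rewrite ler_pdivrMl.
Qed.

End FlagStep.

(** * Flags and the perturbation estimate *)

(** A flag splits the space: with [pi i] a projector onto [F i] such that
    [pi i = projv (F i) \o pi i.+1], the differences [pi i.+1 - pi i] are
    projectors onto complements of [F i] in [F i.+1], and they sum to the
    identity. *)
Lemma flag_decomposition (K : fieldType) (vT : vectType K) m
    (F : nat -> {vspace vT}) :
  F 0%N = 0%VS -> F m = fullv -> (forall i, (i < m)%N -> (F i <= F i.+1)%VS) ->
  exists P : nat -> 'End(vT),
    [/\ forall i x, (i < m)%N -> P i x \in F i.+1,
        forall i x, (i < m)%N -> x \in F i -> P i x = 0,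
        forall i x, (i < m)%N -> x \in F i.+1 -> x - P i x \in F i,
        forall i x, (i < m)%N -> P i (P i x) = P i x &
        forall x, \sum_(i < m) P i x = x].
Proof.
move=> F0 Fm Fmono.
pose fix down k : 'End(vT) :=
  if k is k'.+1 then (projv (F (m - k'.+1)%N) \o down k')%VF else \1%VF.
pose pi i := down (m - i)%N.
have piS i x : (i < m)%N -> pi i x = projv (F i) (pi i.+1 x).
  by move=> im; rewrite /pi -(subnSK im) /= comp_lfunE subnSK // subKn // ltnW.
have pi_m x : pi m x = x by rewrite /pi subnn /= id_lfunE.
have pi_mem i x : (i <= m)%N -> pi i x \in F i.
  rewrite leq_eqVlt => /predU1P[->|im]; first by rewrite Fm memvf.
  by rewrite piS // memv_proj.
have pi_id i x : (i <= m)%N -> x \in F i -> pi i x = x.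
  move=> im; rewrite -(subKn im);
    elim: (m - i)%N (leq_subr i m) => [|k IHk] km Fx.
    by rewrite subn0 pi_m.
  have lt_m : (m - k.+1 < m)%N by rewrite ltn_subrL /=; exact: leq_trans km.
  have Fx' : x \in F (m - k.+1).+1%N by exact: subvP (Fmono _ lt_m) x Fx.
  rewrite piS // subnSK // IHk ?projv_id //; first exact: ltnW.
  by rewrite -subnSK.
have pi0 x : pi 0%N x = 0 by apply/eqP; rewrite -memv0 -F0 pi_mem.
exists (fun i => pi i.+1 - pi i); split=> [i x im|i x im Fx|i x im Fx|i x im|x].
- rewrite add_lfunE opp_lfunE rpredB ?pi_mem //.
  exact: subvP (Fmono i im) _ (pi_mem i x (ltnW im)).
- rewrite add_lfunE opp_lfunE !pi_id ?subrr //; first exact: ltnW.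
  exact: subvP (Fmono i im) _ Fx.
- rewrite add_lfunE opp_lfunE [pi i.+1 x]pi_id // opprB subrKC.
  by rewrite pi_mem // ltnW.
- rewrite !add_lfunE !opp_lfunE !linearB /=.
  have Fi : pi i x \in F i.+1.
    exact: subvP (Fmono i im) _ (pi_mem i x (ltnW im)).
  rewrite [pi i.+1 (pi i.+1 x)]pi_id ?pi_mem // [pi i.+1 (pi i x)]pi_id //.
  rewrite [pi i (pi i x)]pi_id ?pi_mem ?(ltnW im) //.
  have -> : pi i (pi i.+1 x) = pi i x.
    by rewrite piS // [pi i.+1 _]pi_id ?pi_mem // -piS.
  by rewrite subrr addr0.
- under eq_bigr do rewrite add_lfunE opp_lfunE.
  rewrite -(big_mkord xpredT (fun i => pi i.+1 x - pi i x)).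
  by rewrite telescope_sumr // pi_m pi0 subr0.
Qed.

(** Consecutive members of a maximal flag admit no invariant subspace strictly
    in between, as inserting it would refine the flag. *)
Lemma maximal_flag_step (K : numFieldType) d (M : set 'M[K]_d) m F i L :
  maximal_invariant_flag M m F -> (i < m)%N -> invariant_subspace M L ->
  (F i <= L)%VS -> (L <= F i.+1)%VS -> L = F i \/ L = F i.+1.
Proof.
move=> [[F0 Fm Fstep Finv] maxF] im invL FL LF;
  apply: contrapT => /not_orP[LFi LFi1].
(* [F] with [L] inserted between positions [i] and [i.+1]. *)
pose G j := if (j <= i)%N then F j else if j == i.+1 then L else F j.-1.
suff : m.+1 = m by move=> /eqP; rewrite eqn_leq ltnn.
apply: (maxF m.+1 G); last first.
  move=> j jm; have [ji|ij] := leqP j i.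
    by exists j; [exact: leqW | rewrite /G ji].
  exists j.+1 => //; rewrite /G leqNgt (leqW ij) /= eqSS.
  by rewrite gtn_eqF.
split.
- by rewrite /G leq0n.
- by rewrite /G leqNgt (leqW im) /= eqSS gtn_eqF.
- move=> j jm; rewrite /G; have [ji|ij] := ltnP j i.
    by rewrite (ltnW ji); apply: Fstep; exact: ltn_trans im.
  rewrite eqSS; have [->|ji] := eqVneq j i.
    by rewrite leqnn /=; split=> //; apply/eqP => /esym.
  have {}ij : (i < j)%N by rewrite ltn_neqAle eq_sym ji.
  rewrite leqNgt ij /=.
  case: eqP => [->|/eqP ji1]; first by split=> //; exact/eqP.
  have j1 : j.-1.+1 = j by rewrite prednK // (leq_ltn_trans _ ij).
  by have := Fstep j.-1; rewrite j1; apply.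
move=> j jm; rewrite /G; case: leqP => ji; first by apply: Finv;
  exact: leq_trans (ltnW im).
case: eqP => // _; apply: Finv; rewrite -ltnS prednK //.
exact: leq_ltn_trans ji.
Qed.

Section Perturbation.
Context {R : realType} {s : scalar_kind} {d : nat}.
Local Notation K := (base_field R s).
Variables (nu : 'cV[K]_d -> R) (nu_norm : is_norm nu).
Variables (M : set 'M[K]_d) (M0 : M !=set0) (Mb : entry_bounded M).
Variables (m : nat) (F : nat -> {vspace 'cV[K]_d}).
Hypothesis maxF : maximal_invariant_flag M m F.
Local Notation rho := (joint_spectral_radius nu M).
Let nu_sn := norm_seminorm nu_norm.

(** Here [q i] is the extremal seminorm of the [i]-th flag step applied to the
    component [P i x].  The last two clauses say that in these coordinates the
    matrices of [M] are block upper triangular, with diagonal blocks of norm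
    at most [rho]. *)
Lemma adapted_seminorms : exists (P : nat -> 'End('cV[K]_d))
    (q : nat -> 'cV[K]_d -> R),
  [/\ forall i, (i < m)%N -> is_seminorm (q i),
      forall x, \sum_(i < m) P i x = x,
      forall i x, (i < m)%N -> nu (P i x) <= q i x,
      forall A i x, M A -> (i < m)%N -> q i (A *m P i x) <= rho * q i x &
      forall A i j x, M A -> (i < m)%N -> (j < i)%N -> q i (A *m P j x) = 0].
Proof.
have [[F0 Fm Fstep Finv] _] := maxF.
have Fmono i : (i < m)%N -> (F i <= F i.+1)%VS by case/Fstep.
have [P [P_mem P_ker P_sub P_idem P_sum]] := flag_decomposition F0 Fm Fmono.
have /choice [p pP] : forall i, exists p, (i < m)%N ->
    [/\ is_seminorm p, forall x, x \in F i -> p x = 0,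
      forall x, x \in F i.+1 -> nu (P i x) <= p x &
      forall A x, M A -> x \in F i.+1 -> p (A *m x) <= rho * p x].
  move=> i; have [im|mi] := ltnP i m; last first.
    by exists (fun=> 0) => /=.
  have [FS Fneq] := Fstep i im.
  have [|x|x|p pP] := extremal_seminorm nu_norm M0 Mb (Finv i (ltnW im))
    (Finv i.+1 im) FS Fneq _ (P := P i); last by exists p.
  - by move=> L; exact: maximal_flag_step maxF im.
  - exact: P_ker.
  - exact: P_sub.
have Fle i j : (j <= i)%N -> (i <= m)%N -> (F j <= F i)%VS.
  move=> ji; rewrite -(subnKC ji); elim: (i - j)%N => [|k IHk];
    first by rewrite addn0.
  by rewrite addnS => jkm; apply: subv_trans (IHk (ltnW jkm)) (Fmono _ jkm).
exists P, (fun i x => p i (P i x)); split=> //.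
- move=> i im; have [sp _ _ _] := pP i im.
  by apply: (@seminorm_comp _ _ _ _ (P i)) => // a x y; rewrite linearP.
- move=> i x im; have [_ _ pnu _] := pP i im.
  by rewrite -{1}(P_idem i x im) pnu // P_mem.
- move=> A i x MA im; have [sp p0 _ pA] := pP i im.
  have FAx : A *m P i x \in F i.+1 by apply: Finv => //; exact: P_mem.
  rewrite -(seminorm_congr sp (x := A *m P i x)); first exact/pA/P_mem.
  exact/p0/P_sub.
- move=> A i j x MA im ji; have [sp _ _ _] := pP i im.
  rewrite P_ker ?(seminorm0 sp) //; apply: (subvP (Fle i j.+1 ji (ltnW im))).
  by apply: Finv => //;
    [exact: leq_trans ji (ltnW im) | apply: P_mem (ltn_trans ji im)].
Qed.

(** Weighting the [i]-th component by [delta ^ (m - 1 - i)] multiplies the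
    blocks above the diagonal by at most [delta] and those below by at most
    [delta ^ (1 - m)], so that a perturbation of size [delta ^ m] costs no
    more than the blocks above the diagonal: both are of order [delta]. *)
Lemma perturbed_jsr_le b : exists2 C, 0 <= C &
  forall delta (M' : set 'M[K]_d), 0 < delta <= 1 -> M' !=set0 ->
    entry_bounded M' ->
    (forall A', M' A' -> exists A B, [/\ M A, entry_sum B <= b &
       A' = A + of_real s (delta ^+ m) *: B]) ->
    joint_spectral_radius nu M' <= rho + C * delta.
Proof.
have [P [q [q_sn P_sum nu_q q_diag q_low]]] := adapted_seminorms.
have rho0 : 0 <= rho := jsr_ge0 nu_norm M0 Mb.
have q_ge0 i x : (i < m)%N -> 0 <= q i x.
  by move=> im; exact: seminorm_ge0 (q_sn i im) x.
have [c MC] := Mb.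
have [E E0 nuE] := action_bounded nu_norm.
have /choice [D DP] : forall i, exists D, (i < m)%N ->
    0 <= D /\ forall x, q i x <= D * nu x.
  move=> i; have [im|_] := boolP (i < m)%N; last by exists 0 => /=.
  have [D D0 qD] := seminorm_le_norm (q_sn i im) nu_norm.
  by exists D => _; split=> //; exact: ltW.
pose D1 := (\sum_(i < m) D i) * E * (`|b| + `|c|).
have D_ge0 : 0 <= \sum_(i < m) D i.
  by apply: sumr_ge0 => i _; case: (DP i (ltn_ord i)).
have D10 : 0 <= D1 by rewrite !mulr_ge0 ?addr_ge0 // ltW.
have blockD A i j x : entry_sum A <= `|b| + `|c| -> (i < m)%N -> (j < m)%N ->
    q i (A *m P j x) <= D1 * q j x.
  move=> Ac im jm; have [Di0 qD] := DP i im.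
  apply: le_trans (qD _) _.
  apply: le_trans (_ : D i * (E * (`|b| + `|c|) * q j x) <= _).
    rewrite ler_wpM2l //; apply: le_trans (nuE _ _) _.
    apply: ler_pM (seminorm_ge0 nu_sn _) _ (nu_q j x jm).
      by rewrite mulr_ge0 ?(ltW E0) // (seminorm_ge0 entry_sum_seminorm).
    by rewrite ler_pM2l.
  rewrite /D1 -!mulrA ler_wpM2r //.
    by rewrite !mulr_ge0 ?addr_ge0 ?q_ge0 ?(ltW E0).
  rewrite (bigD1 (Ordinal im)) //= lerDl.
  by apply: sumr_ge0 => k _; case: (DP k (ltn_ord k)).
exists (m%:R * (2 * D1)) => [|delta M' /andP[delta0 delta1] M'0 M'b M'E].
  by rewrite mulr_ge0 // mulr_ge0.
pose w i := delta ^+ (m - i.+1).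
have w0 i : 0 < w i by exact: exprn_gt0.
have w_lt i j : (i < j)%N -> (j < m)%N -> w i <= delta * w j.
  move=> ij jm; rewrite /w -exprS ler_wiXn2l ?(ltW delta0) //; lia.
have w_eps i j : (j < m)%N -> delta ^+ m * w i <= delta * w j.
  by move=> jm; rewrite /w -exprS -exprD ler_wiXn2l ?(ltW delta0) //; lia.
pose h x := \sum_(i < m) w i * q i x.
have h_norm : is_norm h.
  split=> [x hx|a x|x y].
  - have nuP (i : 'I_m) : P i x = 0.
      have : w i * q i x = 0.
        apply/eqP; move: hx => /eqP; rewrite psumr_eq0 => [|j _].
          by move=> /allP/(_ i); rewrite mem_index_enum => /(_ isT).
        by rewrite mulr_ge0 ?(ltW (w0 _)) // q_ge0.
      move=> /eqP; rewrite mulf_eq0 gt_eqF //= => /eqP qi.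
      case: nu_norm => + _ _; apply; apply/eqP.
      by rewrite eq_le (seminorm_ge0 nu_sn) andbT -qi nu_q.
    by rewrite -[x]P_sum big1.
  - rewrite /h mulr_sumr; apply: eq_bigr => i _.
    by rewrite (seminormZ (q_sn i (ltn_ord i))) mulrCA.
  - rewrite /h -big_split /=; apply: ler_sum => i _.
    by rewrite -mulrDr ler_pM2l // (seminormD (q_sn i (ltn_ord i))).
apply: (jsr_le nu_norm M'0 M'b h_norm);
  first by rewrite addr_ge0 ?mulr_ge0 // ltW.
move=> _ x /M'E[A [B [MA Bb ->]]].
have Ab : entry_sum A <= `|b| + `|c|.
  by apply: le_trans (MC A MA) _; rewrite ler_wpDl // ler_norm.
have Bb' : entry_sum B <= `|b| + `|c|.
  by apply: le_trans Bb _; rewrite ler_wpDr // ler_norm.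
(* The [i]-th component collects [rho] times itself, those with larger
   index through [A], and all components through the perturbation. *)
have row (i : 'I_m) : w i * q i ((A + of_real s (delta ^+ m) *: B) *m x) <=
    w i * (rho * q i x) + \sum_(j < m) 2 * D1 * delta * (w j * q j x).
  have im := ltn_ord i; have qi := q_sn i im.
  have qB : q i (B *m x) <= \sum_(j < m) D1 * q j x.
    rewrite -{1}[x]P_sum mulmx_sumr; apply: le_trans (seminorm_sum qi _ _ _) _.
    by apply: ler_sum => j _; exact: blockD.
  have qA : q i (A *m x) <= rho * q i x + \sum_(j < m | (i < j)%N) D1 * q j x.
    rewrite -{1}[x]P_sum mulmx_sumr; apply: le_trans (seminorm_sum qi _ _ _) _.
    rewrite (bigD1 i) //= lerD ?q_diag // [leRHS]big_mkcond [leLHS]big_mkcond.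
    apply: ler_sum => j _; case: (ltngtP i j) => [ij|ji|/val_inj->].
    - by rewrite -val_eqE gtn_eqF //= blockD.
    - by rewrite -val_eqE ltn_eqF //= q_low.
    - by rewrite eqxx.
  rewrite mulmxDl -scalemxAl.
  apply: le_trans (_ : w i * (rho * q i x + \sum_(j < m | (i < j)%N) D1 * q j x
      + delta ^+ m * \sum_(j < m) D1 * q j x) <= _).
    rewrite ler_pM2l //; apply: le_trans (seminormD qi _ _) _;
      apply: lerD => //.
    by rewrite (seminormZ qi) modulus_of_real ?exprn_ge0 ?(ltW delta0) //
      ler_wpM2l ?exprn_ge0 ?(ltW delta0).
  rewrite -addrA mulrDr lerD2l mulrDr !mulr_sumr big_mkcond -big_split /=.
  apply: ler_sum => j _.
  have qj := q_ge0 j x (ltn_ord j).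
  have term1 : (if (i < j)%N then w i * (D1 * q j x) else 0) <=
      D1 * delta * (w j * q j x).
    case: ifP => [ij|_]; last by rewrite !mulr_ge0 // ltW.
    rewrite mulrCA -mulrA ler_wpM2l // mulrA ler_wpM2r //.
    exact: w_lt.
  have term2 : w i * (delta ^+ m * (D1 * q j x)) <= D1 * delta * (w j * q j x).
    rewrite mulrA [w i * _]mulrC mulrCA -mulrA ler_wpM2l // mulrA ler_wpM2r //.
    exact: w_eps.
  apply: le_trans (lerD term1 term2) _.
  by rewrite -[2 * D1 * delta]mulrA -[leRHS]mulrA mulr_natl mulr2n.
rewrite /h; apply: le_trans (ler_sum _ (fun i _ => row i)) _.
rewrite big_split /= sumr_const card_ord -mulr_sumr [leRHS]mulrDl; apply: lerD.
  rewrite mulr_sumr; apply: ler_sum => i _; by rewrite mulrCA.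
by rewrite -[leLHS]mulr_natl !mulrA.
Qed.

End Perturbation.

(** * Continuity of the joint spectral radius under perturbation *)

Section PerturbedSets.
Context {R : realType} {s : scalar_kind} {d : nat}.
Local Notation K := (base_field R s).
Variables (N : 'M[K]_d -> R) (N_norm : is_norm N) (V : {vspace 'M[K]_d}).
Variable M : set 'M[K]_d.
Let N_sn := norm_seminorm N_norm.

(** Shrinking an element of the unit ball of [V] keeps it in the ball. *)
Lemma perturbed_mono e1 e2 : 0 <= e1 -> e1 <= e2 ->
  perturbed N V M e1 `<=` perturbed N V M e2.
Proof.
move=> e10 e12 _ [A MA] [B [VB NB] <-].
have [e20|e2N0] := eqVneq e2 0.
  have -> : e1 = e2 by apply/eqP; rewrite eq_le e12 e20.
  by exists A => //; exists B.
have e2p : 0 < e2 by rewrite lt_neqAle eq_sym e2N0 (le_trans e10).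
have e0 : 0 <= e1 / e2 by rewrite divr_ge0 // ltW.
exists A => //; exists (of_real s (e1 / e2) *: B).
  split; first exact: memvZ.
  rewrite (seminormZ N_sn) modulus_of_real // mulr_ile1 ?(seminorm_ge0 N_sn) //.
  by rewrite ler_pdivrMr // mul1r.
by rewrite scalerA -of_realM mulrC divfK.
Qed.

Lemma perturbed0 : perturbed N V M 0 = M.
Proof.
apply/seteqP; split=> [_ [A MA] [B _ <-]|A MA].
  by rewrite of_real0 scale0r addr0.
exists A => //; exists 0; last by rewrite of_real0 scale0r addr0.
by split; [exact: mem0v | rewrite (seminorm0 N_sn)].
Qed.

Lemma perturbed_neq0 e : M !=set0 -> 0 <= e -> perturbed N V M e !=set0.
Proof.
move=> [A MA] e0; exists A; apply: (perturbed_mono (lexx 0) e0).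
by rewrite perturbed0.
Qed.

Lemma perturbed_bounded e :
  entry_bounded M -> 0 <= e -> entry_bounded (perturbed N V M e).
Proof.
move=> [c Mc] e0; have [C C0 NC] := entry_sum_le_norm N_norm.
exists (c + e * C) => _ [A MA] [B [_ NB] <-].
apply: le_trans (seminormD entry_sum_seminorm _ _) _; apply: lerD;
  first exact: Mc.
rewrite (seminormZ entry_sum_seminorm) modulus_of_real // ler_wpM2l //.
by apply: le_trans (NC B) _; rewrite ler_piMr // ltW.
Qed.

End PerturbedSets.

Lemma index_of_reducibility_gt0 (K : numFieldType) d (M : set 'M[K]_d) m :
  (0 < d)%N -> index_of_reducibility M m -> (0 < m)%N.
Proof.
case: d M => // d M _ [F [[F0 Fm _ _] _]].
rewrite lt0n; apply/eqP => m0; move: Fm; rewrite m0 F0 => /esym full0.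
have : (delta_mx 0 0 : 'cV[K]_d.+1) \in fullv by exact: memvf.
rewrite full0 memv0 => /eqP /matrixP /(_ 0 0); rewrite !mxE eqxx /= => /eqP.
by rewrite oner_eq0.
Qed.

Lemma holder_continuous_at_of_bound (R : realType) (f : R -> R) (alpha C : R) :
  (forall x, 0 < x <= 1 -> `|f x - f 0| <= C * x `^ alpha) ->
  @holder_continuous_at R R^o R^o [set x | 0 <= x] f 0 alpha.
Proof.
move=> fC; rewrite /holder_continuous_at limf_esupE.
pose D : set R := [set x | 0 < x <= 1].
apply: le_lt_trans (ltry C); apply: ge_ereal_inf.
exists (ereal_sup [set (mdist (f x : R^o) (f 0) / mdist (x : R^o) 0 `^ alpha)%:E
    | x in D]); last first.
  apply: ge_ereal_sup => _ [x /= Dx <-]; rewrite lee_fin.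
  have /andP[x0 _] := Dx.
  have -> : mdist (f x : R^o) (f 0) = `|f x - f 0| by rewrite [RHS]distrC.
  have -> : mdist (x : R^o) 0 = x.
    by rewrite -[RHS](gtr0_norm x0) -[RHS]normrN -[in RHS]sub0r.
  by rewrite ler_pdivrMr ?powR_gt0 // fC.
exists D => //; rewrite /within /=.
exists 1 => //= x /= x1 [x0 /eqP xN0].
rewrite /D /= lt_neqAle eq_sym xN0 x0 /=.
by move: x1; rewrite sub0r normrN ger0_norm // => /ltW.
Qed.

Set Printing Implicit Defensive.
Set Strict Implicit.
Unset Implicit Arguments.

Theorem proposition13 (R : realType) (s : scalar_kind) (d : nat)
    (d_ge1 : (1 <= d)%N)
    (nu : 'cV[base_field R s]_d -> R) (nu_norm : is_norm nu)
    (N : 'M[base_field R s]_d -> R) (N_norm : is_norm N)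
    (M : set 'M[base_field R s]_d) (M_neq0 : M !=set0) (M_compact : compact M)
    (m : nat) (M_index : index_of_reducibility M m)
    (V : {vspace 'M[base_field R s]_d}) :
  let r : R -> R := fun eps => joint_spectral_radius nu (perturbed N V M eps) in
  [/\ forall eps1 eps2 : R, 0 <= eps1 -> eps1 <= eps2 -> r eps1 <= r eps2,
      @holder_continuous_at R R^o R^o [set eps | 0 <= eps] r 0 m%:R^-1 &
      forall eta : R, 0 < eta -> exists C : R,
        forall eps : R, 0 <= eps <= eta ->
          r eps - r 0 <= C * eps `^ m%:R^-1].
Proof.
move=> r.
have M_bounded := compact_entry_bounded M_compact.
have m_gt0 := index_of_reducibility_gt0 d_ge1 M_index.
have r_mono eps1 eps2 : 0 <= eps1 -> eps1 <= eps2 -> r eps1 <= r eps2.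
  move=> eps1_ge0 le12; apply: (jsr_mono nu_norm).
  - exact: perturbed_neq0.
  - exact: perturbed_bounded (le_trans eps1_ge0 le12).
  - exact: perturbed_mono.
have [b b_gt0 Nb] := entry_sum_le_norm N_norm.
have [F maxF] := M_index.
have [C C_ge0 pert] := perturbed_jsr_le nu_norm M_neq0 M_bounded maxF b.
have r_le eps : 0 < eps <= 1 -> r eps <= r 0 + C * eps `^ m%:R^-1.
  move=> /andP[eps_gt0 eps_le1]; set delta := eps `^ m%:R^-1.
  have deltaX : delta ^+ m = eps.
    rewrite -powR_mulrn ?powR_ge0 // -powRrM mulVf ?powRr1 ?ltW //.
    by rewrite pnatr_eq0 -lt0n.
  have delta_range : 0 < delta <= 1.
    by rewrite powR_gt0 // root_le ?expr1n ?(ltW eps_gt0).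
  rewrite /r (perturbed0 N_norm); apply: (pert _ _ delta_range).
  - exact: perturbed_neq0 (ltW eps_gt0).
  - exact: perturbed_bounded (ltW eps_gt0).
  move=> _ [A MA] [B [VB NB] <-]; exists A, B; rewrite deltaX; split=> //.
  by apply: le_trans (Nb B) _; rewrite ler_piMr // ltW.
split=> [//||eta eta_gt0].
  apply: (@holder_continuous_at_of_bound _ _ _ C) => eps eps_range.
  rewrite ger0_norm ?lerBlDl ?r_le // subr_ge0 r_mono //.
  by case/andP: eps_range => /ltW.
(* Up to 1 the local estimate applies; beyond 1 the root is at least 1 and
   monotonicity bounds the increment by its value at [eta]. *)
exists (C + `|r eta - r 0|) => eps /andP[eps_ge0 eps_le];
  rewrite lerBlDl mulrDl.
have root_ge0 : 0 <= eps `^ m%:R^-1 by exact: powR_ge0.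
have [->|eps_neq0] := eqVneq eps 0.
  by rewrite lerDl addr_ge0 ?mulr_ge0 ?powR_ge0.
have eps_gt0 : 0 < eps by rewrite lt_neqAle eq_sym eps_neq0.
have [eps_le1|eps_gt1] := lerP eps 1.
  apply: le_trans (r_le eps _) _; first by rewrite eps_gt0.
  by rewrite lerD2l lerDl mulr_ge0.
have root_ge1 : 1 <= eps `^ m%:R^-1.
  by rewrite -[leLHS](powRr0 eps) ler_powR ?invr_ge0 // ltW.
apply: le_trans (r_mono eps eta eps_ge0 eps_le) _.
rewrite -lerBlDl; apply: le_trans (ler_norm _) _.
by rewrite -[leLHS]mulr1 ler_wpDl ?mulr_ge0 // ler_wpM2l.
Qed.
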